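(* Almost all cographs have a generalized $Q$-cospectral mate. That is, if $c_n$ denotes the number of isomorphism classes of cographs on $n$ vertices and $q_n$ the number of those isomorphism classes of cographs $G$ on $n$ vertices for which there exists a graph $H$ with $H\not\cong G$ such that $Q(H)$ and $Q(G)$ have the same multiset of eigenvalues and $Q(\overline{H})$ and $Q(\overline{G})$ have the same multiset of eigenvalues, then $q_n/c_n\to 1$ as $n\to\infty$.
   Context: A cograph is a finite simple graph obtained from the single-vertex graph by repeatedly applying disjoint union of two cographs and complementation (equivalently, a graph with no induced path on 4 vertices). $\overline{G}$ denotes the complement of $G$. The signless Laplacian matrix of a graph $G$ is $Q(G)=A(G)+D(G)$, where $A(G)$ is the adjacency matrix and $D(G)$ the diagonal matrix of vertex degrees. Two graphs are generalized $Q$-cospectral if their signless Laplacian matrices have the same eigenvalues (with multiplicity) and the signless Laplacian matrices of their complements have the same eigenvalues. *)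

(* Defs.v *)
From HB Require Import structures.
From mathcomp Require Import all_boot all_order all_algebra all_fingroup all_field.
From mathcomp Require Import boolp.
Set Implicit Arguments. Unset Strict Implicit. Unset Printing Implicit Defensive.
Import Order.TTheory GRing.Theory Num.Theory.
Local Open Scope ring_scope.

Definition adjrel (n : nat) := {ffun 'I_n * 'I_n -> bool}.

Definition simple n (g : adjrel n) : bool :=
  [forall i, ~~ g (i, i)] && [forall i, forall j, g (i, j) == g (j, i)].

Definition compl n (g : adjrel n) : adjrel n :=
  [ffun p => (p.1 != p.2) && ~~ g p].

Definition isob n (g h : adjrel n) : bool :=
  [exists s : {perm 'I_n}, [forall i, forall j, h (s i, s j) == g (i, j)]].

Definition iso_class n (g : adjrel n) : {set adjrel n} :=
  [set h | simple h && isob g h].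

Definition induced_P4 n (g : adjrel n) (a b c d : 'I_n) : bool :=
  [&& uniq [:: a; b; c; d],
      g (a, b), g (b, c), g (c, d),
      ~~ g (a, c), ~~ g (a, d) & ~~ g (b, d)].

Definition cograph n (g : adjrel n) : bool :=
  [forall a, forall b, forall c, forall d, ~~ induced_P4 g a b c d].

Definition deg n (g : adjrel n) (i : 'I_n) : nat := #|[set j | g (i, j)]|.

Definition Qmx n (g : adjrel n) : 'M[algC]_n :=
  \matrix_(i, j) ((g (i, j))%:R + (i == j)%:R * (deg g i)%:R).

(* algebraic multiplicity of a as an eigenvalue of a square matrix M
   (0 if a is not an eigenvalue) *)
Definition eig_mult n (M : 'M[algC]_n) (a : algC) : nat := mup a (char_poly M).

Definition same_spectrum n (M N : 'M[algC]_n) : Prop :=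
  forall a : algC, eig_mult M a = eig_mult N a.

Definition gen_Q_cospectral n (g h : adjrel n) : Prop :=
  same_spectrum (Qmx g) (Qmx h) /\ same_spectrum (Qmx (compl g)) (Qmx (compl h)).

Definition has_gQ_mate n (g : adjrel n) : bool :=
  `[< exists h : adjrel n, [/\ simple h, ~~ isob g h & gen_Q_cospectral g h] >].

Definition cograph_classes n : nat :=
  #|[set iso_class g | g in [set g : adjrel n | simple g && cograph g]]|.

Definition mated_cograph_classes n : nat :=
  #|[set iso_class g | g in [set g : adjrel n | [&& simple g, cograph g & has_gQ_mate g]]]|.

(* Main.v *)
Require Import Defs.
From mathcomp Require Import all_boot all_order all_algebra all_fingroup all_field.
From mathcomp Require Import boolp ring zify.
Set Implicit Arguments. Unset Strict Implicit. Unset Printing Implicit Defensive.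
Import Order.TTheory GRing.Theory Num.Theory.
Local Open Scope ring_scope.

(** A star module of [G] is a module inducing [K_{1,3}]. Complementing [G] inside
    it gives [K_1 + K_3], and conjugation by the orthogonal matrix equal to
    [J/2 - I] on the module and to [I] elsewhere maps [Q(G)] to the new signless
    Laplacian; as this matrix fixes the all-ones vector, the same holds for the
    complements. The degree sequence changes, so a cograph with a star module has
    a mate, and it remains to show that star-free cographs are rare.

    A cograph on [n >= 8] vertices has a module of size [m] between 8 and 16, by
    repeated halving. Contracting it to a vertex [y] loses a bounded amount of
    information, and if [G] is star-free every star module of the rooted graph
    contains [y]. In a graph whose star modules all meet a bounded set, there are
    boundedly many star modules up to automorphism (two that share a leaf or the
    centre are conjugate); hence replacing a root by a star with that root as
    centre is a bounded-to-one map from rooted to unrooted classes. Apply it to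
    [y]. Then, along a chain of modules [S] obtained by halving, add a new vertex
    adjacent to [N(S)], or to [N(S)] and [S]: about [log n] different degrees
    occur, so each class yields about [log n] rooted classes, and replacing the new
    vertex by a star is again bounded-to-one. The resulting cographs have
    [n - m + 8 <= n] vertices, so star-free cographs number [O(c_n / log n)]. *)


(** * Mates from star modules *)

Lemma simpleP n (g : adjrel n) :
  reflect ((forall i, g (i, i) = false) /\ (forall i j, g (i, j) = g (j, i)))
          (simple g).
Proof.
apply: (iffP andP) => [[/forallP irr /forallP sym]|[irr sym]]; split.
- by move=> i; apply: negbTE.
- by move=> i j; have /forallP/(_ j)/eqP := sym i.
- by apply/forallP => i; rewrite irr.
- by apply/forallP => i; apply/forallP => j; rewrite sym.
Qed.

(* [w] lists the leaves of the star and [a] is its centre. *)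
Definition star_module n (g : adjrel n) (w : 'I_3 -> 'I_n) (a : 'I_n) : Prop :=
  [/\ injective w, forall i, w i != a
    & forall i v, g (v, w i) = (v == a) || (v \notin codom w) && g (v, a)].

Definition flip_in n (g : adjrel n) (S : {set 'I_n}) : adjrel n :=
  [ffun p => if (p.1 \in S) && (p.2 \in S) then (p.1 != p.2) && ~~ g p else g p].

Lemma simple_flip_in n (g : adjrel n) S : simple g -> simple (flip_in g S).
Proof.
move=> /simpleP[irr sym]; apply/simpleP; split=> [i|i j]; rewrite !ffunE /=.
  by rewrite eqxx irr; case: ifP.
by rewrite andbC (eq_sym i) (sym i).
Qed.

(* [Qmx g] is [signless_laplacian algC g] by conversion. *)
Definition signless_laplacian (F : numFieldType) n (g : adjrel n) : 'M[F]_n :=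
  \matrix_(i, j) ((g (i, j))%:R + (i == j)%:R * (deg g i)%:R).

(** The Godsil-McKay switching matrix. For [#|S| = 4] the block [J/4] projects onto the all-ones
    vector, so [J/2 - I] is the reflection that fixes this vector and negates its orthogonal
    complement. *)
Definition half_reflection (F : numFieldType) n (S : {set 'I_n}) : 'M[F]_n :=
  \matrix_(i, j) ((i == j)%:R * (if j \in S then -1 else 1)
                  + (i \in S)%:R * (j \in S)%:R / 2).

Lemma degE n (g : adjrel n) i : deg g i = (\sum_j g (i, j))%N.
Proof. by rewrite /deg -sum1dep_card big_mkcond; apply: eq_bigr => j _; case: (g _). Qed.

(** * Conjugation by the half reflection *)

Section HalfReflection.
Variable F : numFieldType.
Local Notation half_reflection := (half_reflection F).
Local Notation Qm := (@signless_laplacian F _).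

Lemma mulmx_half_reflection n (S : {set 'I_n}) (M : 'M[F]_n) i j :
  (M *m half_reflection S) i j =
  M i j * (if j \in S then -1 else 1) + (j \in S)%:R / 2 * \sum_(k in S) M i k.
Proof.
rewrite mxE (eq_bigr (fun k => (k == j)%:R * (M i k * (if j \in S then -1 else 1))
   + (j \in S)%:R / 2 * ((k \in S)%:R * M i k))); last first.
  move=> k _; rewrite mxE; case: (k == j); case: (k \in S); case: (j \in S);
  by rewrite ?mulr1n ?mulr0n; field.
rewrite big_split /= -mulr_sumr; congr (_ + _ * _).
  rewrite (bigD1 j) //= eqxx mul1r big1 ?addr0 // => k /negbTE->.
  by rewrite mul0r.
rewrite [RHS]big_mkcond /=; apply: eq_bigr => k _.
by case: (k \in S); rewrite ?mul1r ?mul0r.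
Qed.

Lemma half_reflection_sym n (S : {set 'I_n}) : (half_reflection S)^T = half_reflection S.
Proof.
apply/matrixP => i j; rewrite !mxE eq_sym; case: eqP => [->//|_].
by rewrite !mul0r !add0r [in LHS](mulrC (_ %:R)).
Qed.

(** On four points [J * J = 4 J], hence [(J/2 - I)^2 = J - J + I = I]. *)
Lemma half_reflection_mul n (S : {set 'I_n}) : #|S| = 4%N ->
  half_reflection S *m half_reflection S = 1%:M.
Proof.
move=> cS; apply/matrixP => i j; rewrite mulmx_half_reflection.
rewrite (eq_bigr (fun k => (k == i)%:R * -1 + (i \in S)%:R / 2)); last first.
  by move=> k kS; rewrite mxE kS eq_sym mulr1.
rewrite big_split /= sumr_const cS !mxE.
have -> : \sum_(k in S) (k == i)%:R * -1 = - (i \in S)%:R :> F.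
  case: (boolP (i \in S)) => iS.
    rewrite (bigD1 i) //= eqxx mul1r big1 ?addr0 // => k /andP[_ /negbTE->].
    by rewrite mul0r.
  rewrite big1 ?oppr0 // => k kS; case: eqP => [e|]; last by rewrite mul0r.
  by rewrite -e kS in iS.
case: (eqVneq i j) => [->|_]; case: (i \in S); case: (j \in S);
  rewrite /= ?mulr1n ?mulr0n ?mul0rn; by field.
Qed.

(** As [U] is its own inverse, this is similarity; the nonzero factor [\det U] is cancelled among
    polynomials. *)
Lemma char_poly_conj n (U M N : 'M[F]_n) :
  U *m U = 1%:M -> M *m U = U *m N -> char_poly M = char_poly N.
Proof.
move=> UU MU.
have detU : \det U * \det U = 1 by rewrite -det_mulmx UU det1.
have nz : \det (map_mx polyC U) != 0.
  rewrite det_map_mx polyC_eq0; apply/eqP => d0.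
  by move: detU; rewrite d0 mul0r => /esym/eqP; rewrite oner_eq0.
apply: (mulIf nz); rewrite mulrC [RHS]mulrC [LHS]mulrC /char_poly -!det_mulmx.
rewrite /char_poly_mx mulmxBl mulmxBr -!map_mxM MU; congr (\det (_ - _)).
by rewrite scalar_mxC.
Qed.

(** Adjacency matrices of complements sum to [J - I] and degrees to [n - 1]. A conjugation that
    commutes with [J] therefore passes from [Q] to the complements. *)
Lemma signless_laplacian_compl n (g : adjrel n) : simple g ->
  Qm (compl g) = const_mx 1 + (n%:R - 2)%:M - Qm g.
Proof.
move=> /simpleP[irr sym].
have dC i : (deg (compl g) i + deg g i + 1 = n)%N.
  rewrite !degE -big_split /= -[X in (_ + X)%N]/(true : nat).
  have -> : (true : nat) = (\sum_j (j == i))%N.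
    by rewrite (bigD1 i) //= eqxx big1 // => j /negbTE->.
  rewrite -big_split /= -[RHS]card_ord -sum1_card; apply: eq_bigr => j _.
  rewrite ffunE /= eq_sym; case: eqP => [->|_]; first by rewrite irr.
  by case: (g _).
apply/matrixP => i j; rewrite !mxE ffunE /=.
have /(congr1 (fun m => m%:R : F)) := dC i; rewrite !natrD => dCi.
case: (eqVneq i j) => [<-|ne] /=.
  by rewrite irr -dCi mulr1n mulr0n; ring.
by rewrite mulr0n !mul0r; case: (g _); rewrite ?mulr1n ?mulr0n; ring.
Qed.

End HalfReflection.

(** * Switching a star module *)

Section Mate.
Variable F : numFieldType.
Local Notation half_reflection := (half_reflection F).
Local Notation Qm := (@signless_laplacian F _).
Variables (n : nat) (g : adjrel n) (w : 'I_3 -> 'I_n) (a : 'I_n).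
Hypotheses (sg : simple g) (st : star_module g w a).

Let S : {set 'I_n} := a |: [set w i | i in 'I_3].
Let h := flip_in g S.
(** Since [S] is a module, this is the number of outside neighbours of every vertex of [S]. Centre
    and leaves have degrees [D + 3] and [D + 1] in [g], and [D] and [D + 2] in [h]. *)
Let D := (\sum_(j in ~: S) g (a, j))%N.

Let winj : injective w. Proof. by case: st. Qed.
Let wa i : w i != a. Proof. by case: st. Qed.
Let irr i : g (i, i) = false. Proof. by case/simpleP: sg. Qed.
Let sym i j : g (i, j) = g (j, i). Proof. by case/simpleP: sg. Qed.

Let aNw : a \notin [set w i | i in 'I_3].
Proof. by apply/imsetP => -[i _ e]; have := wa i; rewrite e eqxx. Qed.

Lemma card_star : #|S| = 4%N.
Proof. by rewrite cardsU1 aNw card_imset // card_ord. Qed.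

Let aS : a \in S. Proof. exact: setU11. Qed.
Let wS i : w i \in S. Proof. by rewrite setU1r // imset_f. Qed.

Let starP v : v \in S -> v = a \/ exists i, v = w i.
Proof. by case/setU1P => [->|/imsetP[i _ ->]]; [left|right; exists i]. Qed.

Let sum_star (V : nmodType) (f : 'I_n -> V) :
  \sum_(k in S) f k = f a + (f (w 0) + f (w 1) + f (w 2)).
Proof.
rewrite big_setU1 //= big_imset /=; last by move=> ? ? _ _ /winj.
rewrite !big_ord_recr big_ord0 /= add0r; congr (_ + (f (w _) + f (w _) + f (w _)));
  exact/val_inj.
Qed.

Let gwa i : g (w i, a) = true.
Proof. by rewrite sym; case: st => _ _ ->; rewrite eqxx. Qed.
Let gaw i : g (a, w i) = true. Proof. by rewrite sym gwa. Qed.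
Let gww i j : g (w i, w j) = false.
Proof. by case: st => _ _ ->; rewrite (negbTE (wa i)) codom_f. Qed.
Let gout v k : v \notin S -> k \in S -> g (v, k) = g (v, a).
Proof.
move=> vS /starP[->//|[i ->]]; case: st => _ _ ->.
rewrite !inE negb_or in vS; case/andP: vS => /negbTE-> vw /=.
suff -> : v \notin codom w by [].
by apply: contra vw => /codomP[j ->]; rewrite imset_f.
Qed.

Let hE u v : h (u, v) = if (u \in S) && (v \in S) then (u != v) && ~~ g (u, v)
                        else g (u, v).
Proof. by rewrite ffunE. Qed.

Let degS (k : adjrel n) v : (forall j, j \notin S -> k (v, j) = g (a, j)) ->
  deg k v = (D + (k (v, a) + (k (v, w 0%R) + k (v, w 1%R) + k (v, w 2%R))))%N.
Proof.
move=> out; rewrite degE (bigID (mem S)) /= addnC; congr (_ + _)%N; last exact: sum_star.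
by rewrite /D [RHS](eq_bigl (fun j => j \notin S)) => [|j]; rewrite ?inE //;
  apply: eq_bigr => j /out ->.
Qed.

Let gS v j : v \in S -> j \notin S -> g (v, j) = g (a, j).
Proof. by move=> vS jS; rewrite sym [RHS]sym gout. Qed.

Let hS v j : v \in S -> j \notin S -> h (v, j) = g (a, j).
Proof. by move=> vS jS; rewrite hE vS (negbTE jS) /= gS. Qed.

Let deg_ga : deg g a = (D + 3)%N.
Proof. by rewrite degS => [|j jS]; [rewrite irr !gaw | rewrite gS]. Qed.
Let deg_gw i : deg g (w i) = (D + 1)%N.
Proof. by rewrite degS => [|j jS]; [rewrite gwa !gww | rewrite gS]. Qed.
Let deg_ha : deg h a = D.
Proof.
by rewrite degS => [|j jS]; [rewrite !hE !aS !wS /= eqxx !gaw !andbF addn0 | rewrite hS].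
Qed.
Let deg_hw i : deg h (w i) = (D + 2)%N.
Proof.
rewrite degS => [|j jS]; last by rewrite hS.
rewrite !hE !aS !wS /= gwa !gww !andbF !andbT !(inj_eq winj).
by case: i => -[|[|[|]]].
Qed.
Let deg_out v : v \notin S -> deg h v = deg g v.
Proof. by move=> vS; rewrite !degE; apply: eq_bigr => j _; rewrite hE (negbTE vS). Qed.

Let Qg_sum_out v : v \notin S -> \sum_(k in S) Qm g v k = 4 * (g (v, a))%:R.
Proof.
move=> vS; rewrite (eq_bigr (fun=> (g (v, a))%:R)) => [|k kS].
  by rewrite sumr_const card_star mulr_natl.
rewrite mxE gout //; case: eqP => [e|_]; last by rewrite mul0r addr0.
by rewrite e kS in vS.
Qed.

Let QhE u v : ~~ ((u \in S) && (v \in S)) -> Qm h u v = Qm g u v.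
Proof.
move=> uv; rewrite !mxE hE (negbTE uv); congr (_ + _).
case: eqP => [e|]; last by rewrite !mul0r.
by rewrite deg_out //; move: uv; rewrite -e andbb.
Qed.

Let Qsym (k : adjrel n) : simple k -> (Qm k)^T = Qm k.
Proof.
move=> /simpleP[_ ks]; apply/matrixP => i j; rewrite !mxE ks eq_sym.
by case: eqP => [->|]; rewrite ?mul0r.
Qed.

Let sh : simple h. Proof. exact: simple_flip_in. Qed.

Let conjQ : Qm g *m half_reflection S = half_reflection S *m Qm h.
Proof.
(* Transposing lets the one entry formula [mulmx_half_reflection] serve both sides. *)
have -> : half_reflection S *m Qm h = (Qm h *m half_reflection S)^T.
  by rewrite trmx_mul half_reflection_sym Qsym.
apply/matrixP => i j; rewrite [RHS]mxE !mulmx_half_reflection.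
have Qhs : Qm h j i = Qm h i j by rewrite -[in LHS]Qsym // mxE.
rewrite Qhs; case: (boolP (i \in S)) => iS; case: (boolP (j \in S)) => jS; last first.
- by rewrite QhE ?negb_and ?iS // !mul0r !addr0.
(* The row of an outside vertex has a constant value [c] on [S], and [-c + 4c/2 = c]. *)
- rewrite Qg_sum_out // QhE ?negb_and ?iS //.
  have -> : Qm g i j = (g (i, a))%:R.
    rewrite mxE gout //; case: eqP => [e|_]; last by rewrite mul0r addr0.
    by rewrite e jS in iS.
  by rewrite mulr0n mulr1n !mul0r; field.
- rewrite [in RHS](eq_bigr (Qm g j)) => [|k kS]; last by rewrite QhE // negb_and jS.
  rewrite (Qg_sum_out jS) QhE ?negb_and ?jS ?orbT //.
  have -> : Qm g i j = (g (j, a))%:R.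
    rewrite mxE sym gout //; case: eqP => [e|_]; last by rewrite mul0r addr0.
    by rewrite -e iS in jS.
  by rewrite mulr0n mulr1n !mul0r; field.
rewrite !sum_star !mxE !hE !aS !wS iS jS /=.
(* The three indicators of a leaf sum to 1; eliminating one of them leaves identities that [field]
   can close. *)
have I3 (i' : 'I_3) : (i' == 0)%:R = 1 - (i' == 1)%:R - (i' == 2)%:R :> F.
  by case: i' => -[|[|[|i']]] ? //=; rewrite /= ?mulr1n ?mulr0n; ring.
have I3n (i' k : 'I_3) : (i' != k)%:R = 1 - (i' == k)%:R :> F.
  by case: (i' == k); rewrite /= ?mulr1n ?mulr0n; ring.
case: (starP iS) => [->|[i' ->]]; case: (starP jS) => [->|[j' ->]];
  rewrite ?deg_ga ?deg_gw ?deg_ha ?deg_hw ?eqxx ?irr ?gaw ?gwa ?gww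
    ?(inj_eq winj) ?[a == w _]eq_sym ?(negbTE (wa _)) ?eqxx ?andbF ?andbT ?natrD
    /= ?I3n ?I3 ?mulr1n ?mulr0n; [by field | by field | by field | ].
by case: (eqVneq i' j') => _; rewrite /= ?mulr1n ?mulr0n; field.
Qed.

(** An isomorphism preserves the number of vertices of degree [D + 3]. Degrees outside [S] are
    unchanged, no vertex of [S] has this degree in [h], and [a] has it in [g]. *)
Let not_iso : ~~ isob g h.
Proof.
apply/existsP => -[s /forallP sP].
have {}sP i j : h (s i, s j) = g (i, j) by have /forallP/(_ j)/eqP := sP i.
have ds i : deg h (s i) = deg g i.
  by rewrite !degE (reindex_inj (@perm_inj _ s)); apply: eq_bigr => j _; rewrite sP.
have : (#|[set v | deg h v == D + 3]| = #|[set v | deg g v == D + 3]|)%N.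
  rewrite -[RHS](card_imset _ (@perm_inj _ s)); apply: eq_card => v.
  rewrite -[v](permKV s) mem_imset ?inE ?ds //; exact: perm_inj.
apply/eqP; rewrite neq_ltn; apply/orP; left; apply: proper_card.
apply/properP; split; last first.
  by exists a; rewrite !inE ?deg_ga // deg_ha; move: D => d; lia.
apply/subsetP => v; rewrite !inE; case: (boolP (v \in S)) => [|/deg_out->//].
by case/starP => [->|[i ->]]; rewrite ?deg_ha ?deg_hw; move: D => d; lia.
Qed.

Lemma star_module_mate_aux : exists h' : adjrel n,
  [/\ simple h', ~~ isob g h', char_poly (Qm g) = char_poly (Qm h')
    & char_poly (Qm (compl g)) = char_poly (Qm (compl h'))].
Proof.
have cS := half_reflection_mul F card_star.
exists h; split=> //; first exact: (char_poly_conj cS conjQ).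
apply: (char_poly_conj cS).
rewrite !signless_laplacian_compl // mulmxBl mulmxBr conjQ; congr (_ - _).
rewrite mulmxDl mulmxDr scalar_mxC; congr (_ + _).
(* Columns of the half reflection sum to 1, those in [S] because [-1 + 4/2 = 1]; by symmetry [J] is
   fixed from the left too. *)
have J1 : const_mx 1 *m half_reflection S = const_mx 1 :> 'M[F]_n.
  apply/matrixP => i j; rewrite mulmx_half_reflection.
  rewrite (eq_bigr (fun=> 1)) => [|k _]; last by rewrite mxE.
  by rewrite sumr_const card_star !mxE; case: (j \in S); rewrite /= ?mulr1n ?mulr0n; field.
by rewrite J1 -[LHS]trmx_const -[in LHS]J1 trmx_mul half_reflection_sym trmx_const.
Qed.

End Mate.

Lemma star_module_mate n (g : adjrel n) w a :
  simple g -> star_module g w a -> has_gQ_mate g.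
Proof.
move=> sg st; have [h [sh hN e1 e2]] := star_module_mate_aux algC sg st.
by apply/asboolP; exists h; split=> //; split=> x;
  rewrite /eig_mult ?[char_poly _]e1 ?[char_poly _]e2.
Qed.

(** * Modules of cographs *)

Local Open Scope nat_scope.

(** Distinctness is left out: for a symmetric irreflexive relation the edge pattern forces it. *)
Definition is_P4 (T : Type) (e : rel T) (a b c d : T) : bool :=
  [&& e a b, e b c, e c d, ~~ e a c, ~~ e a d & ~~ e b d].

Lemma P4_uniq (T : eqType) (e : rel T) a b c d : symmetric e -> irreflexive e ->
  is_P4 e a b c d -> uniq [:: a; b; c; d].
Proof.
move=> sym irr /and5P[ab bc cd ac /andP[ad bd]].
rewrite /= !inE !negb_or !andbT; apply/and3P; split; last 1 first.
- by apply: contraTneq cd => ->; rewrite irr.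
- apply/and3P; split; first by apply: contraTneq ab => ->; rewrite irr.
    by apply: contraNneq ad => ->.
  by apply: contraNneq ac => ->; rewrite sym.
- apply/andP; split; first by apply: contraTneq bc => ->; rewrite irr.
  by apply: contraNneq ad => <-.
Qed.

(** Each vertex of a P4 has both a neighbour and a non-neighbour among the other three. *)
Lemma P4_homogeneous_vertex (T : eqType) (e : rel T) a b c d z k :
    symmetric e -> irreflexive e -> is_P4 e a b c d ->
    (forall x, x \in [:: a; b; c; d] -> x != z -> e x z = k) ->
  z \notin [:: a; b; c; d].
Proof.
move=> sym irr P hom; have := P4_uniq sym irr P; rewrite /= !inE !negb_or !andbT.
case/and3P => /and3P[nab nac nad] /andP[nbc nbd] ncd.
have {}hom x : x \in [:: a; b; c; d] -> x != z -> e z x = k by rewrite sym; apply: hom.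
move: P; rewrite /is_P4; case/and5P => ab bc cd ac /andP[ad bd].
apply/and4P; split; apply/eqP => zE; move: hom; rewrite zE => hom.
- by move: ac; rewrite (hom c) ?(inE, eqxx, orbT, eq_sym c) //
    -(hom b) ?ab // ?(inE, eqxx, orbT) // eq_sym.
- by move: bd; rewrite (hom d) ?(inE, eqxx, orbT, eq_sym d) //
    -(hom a) 1?sym ?ab // ?(inE, eqxx, orbT).
- by move: ac; rewrite sym (hom a) ?(inE, eqxx, orbT) //
    -(hom d) ?cd // ?(inE, eqxx, orbT) // eq_sym.
- by move: ad; rewrite sym (hom a) ?(inE, eqxx, orbT) // -(hom c) 1?sym ?cd // ?(inE, eqxx, orbT).
Qed.

Lemma cographP n (g : adjrel n) : simple g ->
  reflect (forall a b c d, ~~ is_P4 (fun x y => g (x, y)) a b c d) (cograph g).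
Proof.
move=> /simpleP[irr sym]; apply: (iffP forallP) => H a; last first.
  apply/forallP => b; apply/forallP => c; apply/forallP => d.
  by apply: contra (H a b c d) => /andP[].
move=> b c d; have /forallP/(_ b)/forallP/(_ c)/forallP/(_ d) := H a.
by apply: contra => P; apply/andP; split; first exact: P4_uniq P.
Qed.

(** * Splitting P4-free graphs *)

Section Split.
Variable T : finType.
Implicit Types (e r : rel T) (A B C : {set T}).

Definition homogeneous_split e A C (c : bool) : Prop :=
  [/\ C != set0, C \proper A
    & forall x y, x \in C -> y \in A -> y \notin C -> e x y = c].

Lemma homogeneous_splitC e A C c : symmetric e ->
  homogeneous_split e A C c -> homogeneous_split e A (A :\: C) c.
Proof.
move=> sym [/set0Pn[x xC] /properP[/subsetP CA [y yA yC]] hom]; split.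
- by apply/set0Pn; exists y; rewrite inE yC.
- apply/properP; split; first exact: subsetDl.
  by exists x; [exact: CA | rewrite inE xC].
move=> p q; rewrite !inE => /andP[pC pA] qA; rewrite qA andbT negbK => qC.
by rewrite sym hom.
Qed.

(* [C] is the connected component of [u] in [A]; a neighbour of [v] outside [C]
   would extend an edge of [C] leaving the non-neighbours of [v] to a P4. *)
Lemma split_add_vertex_in e A B u v :
    symmetric e -> (forall a b c d, ~~ is_P4 e a b c d) ->
    homogeneous_split e A B false -> v \notin A -> u \in B -> ~~ e v u ->
  exists C, homogeneous_split e (v |: A) C false.
Proof.
move=> sym P4 [B0 BA noB] vA uB vu.
pose P C := [&& u \in C, C \subset B &
  [forall x in C, forall (y | (y \in A) && (y \notin C)), ~~ e x y]].
have PB : P B.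
  rewrite /P uB subxx; apply/forall_inP => x xB; apply/forall_inP => y /andP[yA yB].
  by rewrite noB.
have [C /minsetP[/and3P[uC CB /forall_inP clC] minC] _] := minset_exists PB.
have {}clC x y : x \in C -> y \in A -> y \notin C -> e x y = false.
  by move=> xC yA yC; have /forall_inP/(_ y) := clC x xC; rewrite yA => /(_ yC)/negbTE.
have CA : C \subset A := subset_trans CB (proper_sub BA).
have [d dA dC] : exists2 d, d \in A & d \notin C.
  have /properP[_ [d dA dB]] := BA; exists d => //.
  by apply: contra dB; apply: (subsetP CB).
case: (boolP [exists x in C, e v x]) => [/exists_inP[x xC vx]|/exists_inPn vC]; last first.
  exists C; split; first by apply/set0Pn; exists u.
    apply/properP; split; first exact: subset_trans CA (subsetUr _ _).
    by exists d; rewrite // setU1r.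
  move=> x y xC /setU1P[->|]; last by move=> ? ?; apply: clC.
  by move=> _; rewrite sym; apply: negbTE; apply: vC.
(* Without such an edge, the non-neighbours of [v] in [C] would be a closed set containing [u] and
   smaller than the minimal [C]. *)
have [p [q [pC qC pq vp vq]]] : exists p q, [/\ p \in C, q \in C, e p q, ~~ e v p & e v q].
  case: (boolP [exists p in C, [exists q in C, [&& e p q, ~~ e v p & e v q]]]).
    by case/exists_inP => p pC /exists_inP[q qC /and3P[*]]; exists p, q.
  move=> /exists_inPn none; have /setP/(_ x) : [set p in C | ~~ e v p] = C.
    apply: minC; last by apply/subsetP => p; rewrite inE => /andP[].
    apply/and3P; split; first by rewrite inE uC.
      by apply: subset_trans CB; apply/subsetP => p; rewrite inE => /andP[].
    apply/forall_inP => p; rewrite inE => /andP[pC vp].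
    apply/forall_inP => q /andP[qA]; rewrite inE negb_and negbK.
    case: (boolP (q \in C)) => [qC /= vq|qC _]; last by rewrite clC.
    by have /exists_inPn/(_ q qC) := none p pC; rewrite vp vq !andbT.
  by rewrite inE xC vx.
(* A neighbour [z] of [v] in [A :\: C] would make [p], [q], [v], [z] a P4, so [A :\: C] is cut off
   from [C] and [v] together. *)
exists (A :\: C); split; first by apply/set0Pn; exists d; rewrite inE dC.
  apply/properP; split; first exact: subset_trans (subsetDl _ _) (subsetUr _ _).
  by exists v; rewrite ?setU11 // inE negb_and vA orbT.
move=> z y; rewrite inE => /andP[zC zA] /setU1P[->|yA]; last first.
  by rewrite inE yA andbT negbK => yC; rewrite sym clC.
move=> _; apply: contraNF (P4 p q v z) => zv.
by rewrite /is_P4 pq (sym q) vq (sym v) zv (sym p) vp !clC.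
Qed.

(** A vertex adjacent to all of [A] splits off alone. Otherwise a non-neighbour lies in [B] or in
    [A :\: B], and both are sides of the split. *)
Lemma split_add_vertex e A B v :
    symmetric e -> (forall a b c d, ~~ is_P4 e a b c d) ->
    homogeneous_split e A B false -> v \notin A ->
  exists C c, homogeneous_split e (v |: A) C c.
Proof.
move=> sym P4 hs vA.
case: (boolP [forall u in A, e v u]) => [/forall_inP allv|].
  exists [set v], true; have [/set0Pn[x xB] /properP[/subsetP BA _] _] := hs; split.
  - by apply/set0Pn; exists v; rewrite set11.
  - apply/properP; split; first exact: subsetUl.
    exists x; first by rewrite setU1r ?BA.
    by apply: contraNN vA => /set1P <-; apply: BA.
  by move=> ? y /set1P-> /setU1P[->|yA]; [rewrite set11 | rewrite allv].
case/forall_inPn => u uA vu; case: (boolP (u \in B)) => uB.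
  by have [C ?] := split_add_vertex_in sym P4 hs vA uB vu; exists C, false.
have uAB : u \in A :\: B by rewrite inE uB.
have [C ?] := split_add_vertex_in sym P4 (homogeneous_splitC sym hs) vA uAB vu.
by exists C, false.
Qed.

(** Seinsche's theorem: a P4-free graph on at least two vertices is disconnected or has a
    disconnected complement. The induction adds one vertex at a time. *)
Lemma cograph_split e A :
    symmetric e -> irreflexive e -> (forall a b c d, ~~ is_P4 e a b c d) -> 1 < #|A| ->
  exists C c, homogeneous_split e A C c.
Proof.
move=> sym irr P4; have [k] := ubnP #|A|; elim: k A => // k IH A ltk cA.
have /card_gt0P[v vA] : 0 < #|A| by apply: ltnW.
have vA' : v \notin A :\ v by rewrite setD11.
rewrite -(setD1K vA); rewrite (cardsD1 v) vA ltnS add1n in cA ltk.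
have [cA'|cA'] := ltnP 1 #|A :\ v|; last first.
  have /cards1P[u Au] : #|A :\ v| == 1 by rewrite eqn_leq cA'.
  exists [set v], (e v u); rewrite Au in vA' *; split.
  - by apply/set0Pn; exists v; rewrite set11.
  - apply/properP; split; first exact: subsetUl.
    by exists u; rewrite ?setU1r ?inE // eq_sym; move: vA'; rewrite inE.
  by move=> x y /set1P-> /setU1P[->|/set1P->//]; rewrite set11.
have [C [c hs]] := IH _ ltk cA'; case: c hs => hs; last exact: (split_add_vertex sym P4 hs vA').
(* A fully joined split becomes an edgeless one in the complement, which is again P4-free: a P4
   [a b c d] there is the P4 [b d a c] of [e]. *)
pose e' x y := (x != y) && ~~ e x y.
have sym' : symmetric e' by move=> x y; rewrite /e' eq_sym sym.
have P4' a b c d : ~~ is_P4 e' a b c d.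
  apply: contra (P4 b d a c) => /and5P[ab bc cd ac /andP[ad bd]].
  have [eac ebd ead] : [/\ a != c, b != d & a != d].
    split; first by apply: contraNneq ad => ->.
      by apply: contraNneq ad => <-.
    by apply: contraNneq ac => ->; rewrite sym'.
  move: ab bc cd ac ad bd; rewrite /is_P4 /e' eac ebd ead /= !negbK.
  by move=> /andP[_ nab] /andP[_ nbc] /andP[_ ncd] ac ad bd;
    rewrite bd sym ad ac sym nab nbc sym ncd.
have hs' : homogeneous_split e' (A :\ v) C false.
  have [C0 CA hom] := hs; split=> // x y xC yA yC.
  by rewrite /e' hom // andbF.
have [C' [c [C0 CA hom]]] := split_add_vertex sym' P4' hs' vA'.
exists C', (~~ c); split=> // x y xC yA yC.
rewrite -(hom x y) // /e'; case: eqP => [xy|_]; last by rewrite negbK.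
by rewrite xy (negbTE yC) in xC.
Qed.

End Split.

Definition module n (g : adjrel n) (S : {set 'I_n}) : Prop :=
  forall x s t, x \notin S -> s \in S -> t \in S -> g (x, s) = g (x, t).

(** The path P4 has no module of two or three vertices, so a P4 lies inside [S] or meets it at most
    once; in the second case that vertex may be replaced by [s]. *)
Lemma P4_module n (g : adjrel n) (S : {set 'I_n}) s : simple g -> module g S -> s \in S ->
    (forall a b c d, a \in S -> b \in S -> c \in S -> d \in S ->
       ~~ is_P4 (fun x y => g (x, y)) a b c d) ->
    (forall a b c d, {subset [:: a; b; c; d] <= s |: ~: S} ->
       ~~ is_P4 (fun x y => g (x, y)) a b c d) ->
  cograph g.
Proof.
move=> sg mS sS PS PC; apply/(cographP sg) => a b c d; apply/negP => P.
have [irr sym] := simpleP _ sg.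
have M z x y : z \notin S -> x \in S -> y \in S -> g (x, z) = g (y, z).
  by move=> zS xS yS; rewrite !(sym _ z); apply: mS.
pose r x := if x \in S then s else x.
have rP x : r x \in s |: ~: S by rewrite /r !inE; case: ifP => [_|->]; rewrite ?eqxx ?orbT.
have rE x y : ~~ ((x \in S) && (y \in S)) -> g (r x, r y) = g (x, y).
  rewrite /r; case: (boolP (x \in S)) => xS; case: (boolP (y \in S)) => yS //= _.
    exact: M.
  exact: mS.
have few : ~~ [|| (a \in S) && (b \in S), (a \in S) && (c \in S), (a \in S) && (d \in S),
              (b \in S) && (c \in S), (b \in S) && (d \in S) | (c \in S) && (d \in S)].
  move: P (PS a b c d); rewrite /is_P4.
  move: (M a b c) (M a b d) (M a c d) (M b a c) (M b a d) (M b c d).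
  move: (M c a b) (M c a d) (M c b d) (M d a b) (M d a c) (M d b c).
  rewrite !(sym b a) !(sym c a) !(sym d a) !(sym c b) !(sym d b) !(sym d c).
  case: (a \in S); case: (b \in S); case: (c \in S); case: (d \in S) => //=;
  case: (g (a, b)); case: (g (b, c)); case: (g (c, d)); case: (g (a, c)) => //=;
  case: (g (a, d)); case: (g (b, d)) => //=;
  by do ?[move=> /(_ isT isT isT isT) // | move=> /(_ isT isT isT) // | move=> _].
have sub : {subset [:: r a; r b; r c; r d] <= s |: ~: S}.
  by apply/allP; rewrite /= !rP.
apply: (negP (PC _ _ _ _ sub)); move: P.
by move: few; rewrite !negb_or /is_P4 => /and5P[? ? ? ? /andP[? ?]]; rewrite !rE.
Qed.

(** Either side of a split of a module is again a module, and the larger side holds at least half of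
    the vertices. *)
Lemma module_halve n (g : adjrel n) S : simple g -> cograph g -> module g S -> 1 < #|S| ->
  exists C c, [/\ homogeneous_split (fun x y => g (x, y)) S C c, module g C & #|S| <= 2 * #|C|].
Proof.
move=> sg /(cographP sg) P4 mS cS; have [irr sym] := simpleP _ sg.
have symr : symmetric (fun x y => g (x, y)) by move=> x y; rewrite sym.
have mod C c : homogeneous_split (fun x y => g (x, y)) S C c -> module g C.
  move=> [_ /proper_sub/subsetP CS hom] x s t xC sC tC.
  case: (boolP (x \in S)) => xS; last by apply: mS => //; apply: CS.
  by rewrite !(sym x) (hom s x) ?(hom t x).
have [C [c hs]] := cograph_split symr irr P4 cS.
have hs' := homogeneous_splitC symr hs.
have : #|S| = #|C| + #|S :\: C|.
  by have [_ /proper_sub/setIidPr CS _] := hs; rewrite -(cardsID C S) CS.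
case: (leqP #|S :\: C| #|C|) => le cSE; [exists C, c | exists (S :\: C), c]; split=> //.
- exact: mod hs.
- by rewrite cSE mul2n -addnn leq_add2l.
- exact: mod hs'.
- by rewrite cSE mul2n -addnn leq_add2r ltnW.

Qed.

(** * Degrees of new vertices along a chain of modules *)

Section Vicinity.
Variables (n : nat) (g : adjrel n).
Hypotheses (sg : simple g) (cg : cograph g).

(* For a module [S]: the neighbourhood of a new vertex with the same outside
   neighbours as [S], adjacent to all of [S] iff [c]. *)
Definition vicinity (S : {set 'I_n}) (c : bool) : {set 'I_n} :=
  [set x | if x \in S then c else [exists s in S, g (x, s)]].

Lemma vicinity_out (S : {set 'I_n}) x s c : module g S -> x \notin S -> s \in S ->
  (x \in vicinity S c) = g (x, s).
Proof.
move=> mS xS sS; rewrite inE (negbTE xS); apply/exists_inP/idP => [[t tS]|gs].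
  by rewrite (mS x s t).
by exists s.
Qed.

Lemma vicinity_in (S : {set 'I_n}) x c : x \in S -> (x \in vicinity S c) = c.
Proof. by move=> xS; rewrite inE xS. Qed.

(** The degrees that a new vertex can get from the nonempty modules inside [S]; different degrees
    will give different rooted classes. *)
Definition vicinity_sizes (S : {set 'I_n}) (c : bool) : {set 'I_n.+1} :=
  [set d : 'I_n.+1 | `[< exists C : {set 'I_n}, [/\ C \subset S, C != set0, module g C
                                     & #|vicinity C c| = d] >]].

Lemma vicinity_sizes_self (S : {set 'I_n}) c : module g S -> S != set0 ->
  exists2 d : 'I_n.+1, d \in vicinity_sizes S c & #|vicinity S c| = d.
Proof.
move=> mS S0.
have ltn : #|vicinity S c| < n.+1 by rewrite ltnS -[leqRHS]card_ord max_card.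
by exists (Ordinal ltn); rewrite // inE; apply/asboolP; exists S.
Qed.

(** Each halving yields one new size, starting from one for each flag. *)
Lemma vicinity_sizes_card (S : {set 'I_n}) j : module g S -> 2 ^ j <= #|S| ->
  j.+2 <= #|vicinity_sizes S false| + #|vicinity_sizes S true|.
Proof.
elim: j S => [|j IH] S mS cS.
  have S0 : S != set0 by rewrite -card_gt0.
  have pos c : 0 < #|vicinity_sizes S c|.
    by have [d dS _] := vicinity_sizes_self c mS S0; apply/card_gt0P; exists d.
  by rewrite (leq_add (pos false) (pos true)).
have S2 : 1 < #|S| by apply: leq_trans cS; rewrite expnS -[2]/(2 * 1) leq_mul // expn_gt0.
have S0 : S != set0 by rewrite -card_gt0 ltnW.
have [C [c [[C0 CS hom] mC leC]]] := module_halve sg cg mS S2.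
have {}IH : j.+2 <= #|vicinity_sizes C false| + #|vicinity_sizes C true|.
  by apply: IH; rewrite // -(leq_pmul2l (isT : 0 < 2)) -expnS (leq_trans cS).
have sub b : vicinity_sizes C b \subset vicinity_sizes S b.
  apply/subsetP => d; rewrite !inE => /asboolP[B [BC B0 mB dB]].
  by apply/asboolP; exists B; split=> //; apply: subset_trans BC (proper_sub CS).
(* The size from [S] itself with flag [~~ c] is new. For [B] inside [C], the two vicinities agree
   outside [S]; on [S] the one of [S] is constantly [~~ c], while [y] in [S] but not in [C] has
   value [c] for [B]. So one properly contains the other. *)
have prop : vicinity_sizes C (~~ c) \proper vicinity_sizes S (~~ c).
  have [d dS dE] := vicinity_sizes_self (~~ c) mS S0.
  apply/properP; split=> //; exists d => //; rewrite inE; apply/asboolP => -[B [BC B0 mB]].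
  rewrite -dE; have /set0Pn[s sB] := B0.
  have sC := subsetP BC s sB; have /properP[/subsetP CS' [y yS yC]] := CS.
  have sS := CS' s sC.
  have yB : y \notin B by apply: contra yC; apply: (subsetP BC).
  have ys : g (y, s) = c by have [_ sym] := simpleP _ sg; rewrite sym hom.
  have out x : x \notin S -> x \notin B by apply: contra => /(subsetP BC)/CS'.
  have agree x b : x \notin S -> (x \in vicinity S b) = (x \in vicinity B b).
    by move=> xS; rewrite (vicinity_out _ mS xS sS) (vicinity_out _ mB (out _ xS) sB).
  have yV := vicinity_out (~~ c) mB yB sB; rewrite ys in yV.
  move=> eq; have /eqP := eq; apply/negP; rewrite neq_ltn; apply/orP.
  clear d dS dE eq; case: c {hom ys} agree yV => agree yV; [right|left]; apply: proper_card;
    apply/properP; split; try by exists y; rewrite // ?yV ?(vicinity_in _ yS).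
    apply/subsetP => x; case: (boolP (x \in S)) => xS; first by rewrite (vicinity_in _ xS).
    by rewrite agree.
  apply/subsetP => x; case: (boolP (x \in S)) => xS; first by rewrite (vicinity_in _ xS).
  by rewrite agree.
move: (proper_card prop) (subset_leq_card (sub c)); case: (c) => lt le.
  by apply: leq_trans (leq_add lt le); rewrite addSn ltnS.
by apply: leq_trans (leq_add le lt); rewrite addnS ltnS.
Qed.

Lemma vicinity_sizes_large k : 2 ^ (2 * k) <= n ->
  exists c, k <= #|vicinity_sizes setT c|.
Proof.
move=> len; have mT : module g setT by move=> x ? ?; rewrite inE.
have := vicinity_sizes_card (j := 2 * k) mT; rewrite cardsT card_ord => /(_ len).
by case: (leqP k #|vicinity_sizes setT false|) => lek; [exists false | exists true; lia].
Qed.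

End Vicinity.

(** * Induced embeddings, adding a vertex, inserting a star *)

Definition embeds k n (f : 'I_k -> 'I_n) (h : adjrel k) (g : adjrel n) : Prop :=
  injective f /\ forall i j, g (f i, f j) = h (i, j).

Lemma embeds_simple k n f (h : adjrel k) (g : adjrel n) :
  embeds f h g -> simple g -> simple h.
Proof.
by move=> [_ fE] /simpleP[irr sym]; apply/simpleP; split=> *; rewrite -!fE ?irr // sym.
Qed.

Lemma embeds_cograph k n f (h : adjrel k) (g : adjrel n) :
  embeds f h g -> simple g -> cograph g -> cograph h.
Proof.
move=> fE sg /(cographP sg) P4; apply/(cographP (embeds_simple fE sg)) => a b c d.
by have := P4 (f a) (f b) (f c) (f d); rewrite /is_P4 !fE.2.
Qed.

Lemma embeds_P4 k n f (h : adjrel k) (g : adjrel n) a b c d :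
  simple h -> cograph h -> embeds f h g -> {subset [:: a; b; c; d] <= codom f} ->
  ~~ is_P4 (fun x y => g (x, y)) a b c d.
Proof.
move=> sh /(cographP sh) P4 [_ fE] /allP /=.
case/and5P => /codomP[a' ->] /codomP[b' ->] /codomP[c' ->] /codomP[d' ->] _.
by rewrite /is_P4 !fE; apply: P4.
Qed.

Definition add_vertex n (g : adjrel n) (N : {set 'I_n}) : adjrel n.+1 :=
  [ffun p => match unlift ord0 p.1, unlift ord0 p.2 with
             | Some i, Some j => g (i, j)
             | Some i, None | None, Some i => i \in N
             | None, None => false
             end].

Section AddVertex.
Variables (n : nat) (g : adjrel n) (N : {set 'I_n}).
Local Notation up := (lift (@ord0 n)).

Lemma add_vertexE :
  [/\ forall i j, add_vertex g N (up i, up j) = g (i, j),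
      forall i, add_vertex g N (up i, ord0) = (i \in N),
      forall i, add_vertex g N (ord0, up i) = (i \in N)
    & add_vertex g N (ord0, ord0) = false].
Proof. by split=> *; rewrite ffunE /= ?liftK ?unlift_none. Qed.

Lemma embeds_add_vertex : embeds up g (add_vertex g N).
Proof. by split; [exact: lift_inj | case: add_vertexE]. Qed.

Lemma simple_add_vertex : simple g -> simple (add_vertex g N).
Proof.
have [E1 E2 E3 E4] := add_vertexE => /simpleP[irr sym]; apply/simpleP; split=> [i|i j].
  by case: (unliftP ord0 i) => [i'|] ->; rewrite ?E1 ?irr.
by case: (unliftP ord0 i) => [i'|] ->; case: (unliftP ord0 j) => [j'|] ->;
  rewrite ?E1 ?E2 ?E3 ?(sym i').
Qed.

Lemma deg_add_vertex : deg (add_vertex g N) ord0 = #|N|.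
Proof.
have [E1 E2 E3 E4] := add_vertexE; rewrite degE big_ord_recl E4 add0n -sum1_card [RHS]big_mkcond.
by apply: eq_bigr => i _; rewrite E3; case: (_ \in _).
Qed.
End AddVertex.

(** The new vertex and [S] form a module [S'] in which the new vertex is homogeneous to the rest, so
    no P4 inside [S'] uses it. With [up s] representing [S'], the remaining quadruples also lie in
    the copy of [g]. *)
Lemma cograph_add_vertex n (g : adjrel n) (S : {set 'I_n}) c :
  simple g -> cograph g -> module g S -> S != set0 ->
  cograph (add_vertex g (vicinity g S c)).
Proof.
move=> sg cg mS /set0Pn[s sS]; set N := vicinity g S c; set h := add_vertex g N.
have [E1 E2 E3 E4] := add_vertexE g N; have emb := embeds_add_vertex g N.
pose up := lift (@ord0 n); pose S' := ord0 |: [set up i | i in S].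
have upS i : (up i \in S') = (i \in S).
  by rewrite in_setU1 -[X in X || _]negbK eq_sym neq_lift mem_imset //; apply: lift_inj.
have up0 i : up i != ord0 by rewrite eq_sym neq_lift.
have sh : simple h by apply: simple_add_vertex.
have [irr sym] := simpleP _ sh.
apply: (@P4_module _ _ S' (up s)); rewrite ?upS //.
- have key x t : x \notin S -> t \in S' -> h (up x, t) = g (x, s).
    move=> xS /setU1P[->|/imsetP[t' tS ->]]; first by rewrite E2 (vicinity_out c mS xS sS).
    by rewrite E1; apply: mS.
  move=> x t u; case: (unliftP ord0 x) => [x'|] ->; last by rewrite setU11.
  by rewrite -/up upS => xS tS uS; rewrite !key.
- have key t : t \in S' -> t != ord0 -> h (ord0, t) = c.
    move=> /setU1P[->|/imsetP[t' tS ->]]; first by rewrite eqxx.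
    by rewrite E3 /N vicinity_in.
  move=> a b d e aS bS dS eS; apply/negP => P.
  have ord0N : ord0 \notin [:: a; b; d; e].
    apply: (P4_homogeneous_vertex (k := c) _ _ P) => [x y|x|x]; rewrite ?irr 1?sym //.
    have all4 : all [in S'] [:: a; b; d; e] by rewrite /= aS bS dS eS.
    by move=> xP; apply: key; apply: (allP all4).
  apply/negP: P; apply: (embeds_P4 sg cg emb) => x xP.
  case: (unliftP ord0 x) xP => [x' -> _|->]; first exact: codom_f.
  by rewrite (negbTE ord0N).
- move=> a b d e sub; apply: (embeds_P4 sg cg emb) => x /sub.
  case: (unliftP ord0 x) => [x'|] -> ; first by move=> _; exact: codom_f.
  by rewrite !inE eqxx orbF eq_sym (negbTE (up0 s)).
Qed.

(** Substitutes a star for [y]. The vertex [y] stays as the centre, so [g] remains an induced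
    subgraph, and the three right-hand vertices are the leaves. *)
Definition blow_star n (g : adjrel n) (y : 'I_n) : adjrel (n + 3) :=
  [ffun p => match split p.1, split p.2 with
             | inl i, inl j => g (i, j)
             | inl i, inr _ | inr _, inl i => (i == y) || g (i, y)
             | inr _, inr _ => false
             end].

Section BlowStar.
Variables (n : nat) (g : adjrel n) (y : 'I_n).
Local Notation l := (@lshift n 3).
Local Notation r := (@rshift n 3).

Lemma blow_starE :
  [/\ forall i j, blow_star g y (l i, l j) = g (i, j),
      forall i k, blow_star g y (l i, r k) = (i == y) || g (i, y),
      forall i k, blow_star g y (r k, l i) = (i == y) || g (i, y)
    & forall k m, blow_star g y (r k, r m) = false].
Proof.
by split=> *; rewrite ffunE /= -?[lshift _ _]/(unsplit (inl _))
  -?[rshift _ _]/(unsplit (inr _)) !unsplitK.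
Qed.

Lemma embeds_blow_star : embeds l g (blow_star g y).
Proof. by split; [exact: lshift_inj | case: blow_starE]. Qed.

Lemma simple_blow_star : simple g -> simple (blow_star g y).
Proof.
have [E1 E2 E3 E4] := blow_starE => /simpleP[irr sym]; apply/simpleP; split=> [i|i j].
  by case: (split_ordP i) => i' ->; rewrite ?E1 ?E4.
by case: (split_ordP i) => i' ->; case: (split_ordP j) => j' ->;
  rewrite ?E1 ?E2 ?E3 ?E4 ?(sym i').
Qed.

Lemma star_module_blow_star : simple g -> star_module (blow_star g y) r (l y).
Proof.
have [E1 E2 E3 E4] := blow_starE => /simpleP[irr sym].
split; [exact: rshift_inj | by move=> i; rewrite eq_rlshift | move=> i v].
have [v' ->|v' ->] := split_ordP v; last by rewrite E4 eq_rlshift codom_f.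
rewrite E1 E2 (inj_eq (@lshift_inj _ _)); congr (_ || _).
suff -> : l v' \notin codom r by [].
by apply/codomP => -[k] /eqP; rewrite eq_lrshift.
Qed.

(** The star is a module, it is complete bipartite and hence P4-free, and its centre represents it
    inside the copy of [g]. *)
Lemma cograph_blow_star : simple g -> cograph g -> cograph (blow_star g y).
Proof.
move=> sg cg; set h := blow_star g y.
have [E1 E2 E3 E4] := blow_starE; have emb := embeds_blow_star.
pose S := l y |: [set r k | k in 'I_3].
have lS i : (l i \in S) = (i == y).
  rewrite in_setU1 (inj_eq (@lshift_inj _ _)); case: eqP => //= _.
  by apply/imsetP => -[k _] /eqP; rewrite eq_lrshift.
have SP x : x \in S -> x = l y \/ exists k, x = r k.
  by case/setU1P => [|/imsetP[k _]]; [left | right; exists k].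
have sh : simple h by apply: simple_blow_star.
have [irr sym] := simpleP _ sh; have [girr gsym] := simpleP _ sg.
apply: (@P4_module _ _ S (l y)); rewrite ?lS //.
- have key x t : x != y -> t \in S -> h (l x, t) = g (x, y).
    by move=> xy /SP[->|[k ->]]; rewrite ?E1 ?E2 ?(negbTE xy).
  move=> x t u; have [x' ->|k ->] := split_ordP x.
    by rewrite lS => xS tS uS; rewrite !key.
  by rewrite in_setU1 imset_f ?orbT.
- have key x t : x \in S -> t \in S -> h (x, t) = ((x == l y) != (t == l y)).
    move=> /SP[->|[k ->]] /SP[->|[m ->]];
    by rewrite ?E1 ?E2 ?E3 ?E4 ?eqxx ?girr ?eq_rlshift.
  move=> a b c d aS bS cS dS; rewrite /is_P4 !key //.
  by case: (a == _); case: (b == _); case: (c == _); case: (d == _).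
- move=> a b c d sub; apply: (embeds_P4 sg cg emb) => x /sub.
  have [x' ->|k ->] := split_ordP x; first by move=> _; exact: codom_f.
  by rewrite !inE eq_rlshift imset_f ?orbT.
Qed.
End BlowStar.

Lemma star_module_embeds k n f (h : adjrel k) (g : adjrel n) w a :
  embeds f h g -> star_module g (f \o w) (f a) -> star_module h w a.
Proof.
move=> [fI fE] [wI wa adj]; split=> [i j ij|i|i v].
- by apply: wI => /=; rewrite ij.
- by apply: contra (wa i) => /eqP /= ->.
rewrite -!fE [LHS]adj (inj_eq fI); congr (_ || ~~ _ && _).
by apply/codomP/codomP => -[j] => [/fI|] ->; exists j.
Qed.

Definition star_hitting n (g : adjrel n) (X : {set 'I_n}) : Prop :=
  forall w a, star_module g w a -> a \in X \/ exists i, w i \in X.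

(** A relaxation of star-freeness, which is the case [r = 0]. It survives the addition of vertices
    at the price of a larger [r]. *)
Definition star_hit n (r : nat) (g : adjrel n) : bool :=
  `[< exists2 X : {set 'I_n}, star_hitting g X & #|X| <= r >].

(** A star module inside the image restricts to one of [h]; any other contains one of the [n - k]
    vertices outside the image. *)
Lemma star_hit_embeds k n f (h : adjrel k) (g : adjrel n) r :
  embeds f h g -> star_hit r h -> star_hit (r + (n - k)) g.
Proof.
move=> emb /asboolP[X hX cX]; have [fI fE] := emb.
apply/asboolP; exists (f @: X :|: ~: (f @: setT)).
  move=> w a st; have [/imsetP[a' _ aE]|aN] := boolP (a \in f @: setT); last first.
    by left; rewrite inE [in X in _ || X]inE aN orbT.
  case: (boolP [forall i, w i \in f @: setT]) => [/forallP wT|]; last first.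
    by case/forallPn => i wN; right; exists i; rewrite inE [in X in _ || X]inE wN orbT.
  have /choice[w' wE] i : exists j, w i = f j by have /imsetP[j _ ->] := wT i; exists j.
  have st' : star_module g (f \o w') (f a').
    by rewrite -aE; have -> : f \o w' = w by apply/funext => i /=.
  have [aX|[i wX]] := hX _ _ (star_module_embeds emb st').
    by left; rewrite aE in_setU imset_f.
  by right; exists i; rewrite wE in_setU imset_f.
apply: leq_trans (leq_card_setU _ _) _; apply: leq_add.
  exact: leq_trans (leq_imset_card _ _) cX.
by rewrite cardsCs setCK card_imset // cardsT !card_ord.
Qed.

(** * Counting isomorphism classes *)

Section CardRelation.
Variables (TA TB : finType) (A : {set TA}) (B : {set TB}) (rho : TA -> TB -> Prop).

Lemma leq_card_fiber d :
    (forall a, a \in A -> exists2 b, b \in B & rho a b) ->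
    (forall b (A' : {set TA}), b \in B -> A' \subset A ->
       (forall a, a \in A' -> rho a b) -> #|A'| <= d) ->
  #|A| <= d * #|B|.
Proof.
move=> tot fib; pose f a := [pick b in B | `[< rho a b >]].
have fP a : a \in A -> exists b, [/\ b \in B, rho a b & f a = Some b].
  move=> /tot[b0 b0B b0P]; rewrite /f; case: pickP => [b /andP[bB /asboolP bP]|/(_ b0)].
    by exists b.
  by rewrite b0B => /asboolP.
rewrite -sum1_card (partition_big f (mem (Some @: B))) /=; last first.
  by move=> a /fP[b [bB _ ->]]; rewrite imset_f.
have someI : injective (@Some TB) by move=> ? ? [].
rewrite mulnC -(card_imset _ someI) -sum_nat_const.
apply: leq_sum => _ /imsetP[b bB ->]; rewrite -[X in _ <= X]muln1.
rewrite (eq_bigl [in [set a in A | f a == Some b]]) => [|a]; last by rewrite inE.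
rewrite sum1_card muln1; apply: (fib b) => //.
  by apply/subsetP => a; rewrite inE => /andP[].
by move=> a; rewrite inE => /andP[/fP[b' [_ ? ->]] /eqP[<-]].
Qed.

Lemma leq_card_rel :
    (forall a, a \in A -> exists2 b, b \in B & rho a b) ->
    (forall a a' b, a \in A -> a' \in A -> rho a b -> rho a' b -> a = a') ->
  #|A| <= #|B|.
Proof.
move=> tot fun_; rewrite -[#|B|]mul1n; apply: leq_card_fiber => // b A' bB sub A'b.
apply/card_le1_eqP => a a' aA a'A.
by apply: (fun_ a' a b); rewrite ?(subsetP sub) //; apply: A'b.
Qed.

(** Double counting of related pairs: at least [k] for each [a], at most one for each [b]. *)
Lemma leq_mul_card_rel k :
    (forall a, a \in A -> k <= #|[set b in B | `[< rho a b >]]|) ->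
    (forall a a' b, a \in A -> a' \in A -> rho a b -> rho a' b -> a = a') ->
  #|A| * k <= #|B|.
Proof.
move=> many fun_; rewrite -sum_nat_const.
apply: (@leq_trans (\sum_(a in A) #|[set b in B | `[< rho a b >]]|)); first exact: leq_sum.
under eq_bigr do rewrite -sum1_card.
rewrite (exchange_big_dep (mem B)) /= => [|a b _]; last by rewrite inE => /andP[].
rewrite -[leqRHS]sum1_card; apply: leq_sum => b bB.
rewrite (eq_bigl [in [set a in A | `[< rho a b >]]]) => [|a]; last by rewrite !inE bB.
rewrite sum1_card; apply/card_le1_eqP => a a'.
by rewrite !inE => /andP[aA /asboolP ab] /andP[a'A /asboolP a'b]; apply: (fun_ _ _ b).
Qed.

End CardRelation.

Lemma embeds_comp k m n f1 f2 (g1 : adjrel k) (g2 : adjrel m) (g3 : adjrel n) :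
  embeds f1 g1 g2 -> embeds f2 g2 g3 -> embeds (f2 \o f1) g1 g3.
Proof.
by move=> [i1 e1] [i2 e2]; split=> [|i j]; [exact: inj_comp | rewrite /= e2 e1].
Qed.

Lemma embeds_id n (g : adjrel n) : embeds id g g.
Proof. by split=> // i j. Qed.

(** Injective self-maps of a finite set are bijective, so [embeds] between graphs of equal order
    expresses isomorphism. *)
Lemma embeds_inv n f (g h : adjrel n) : embeds f g h ->
  exists f', [/\ embeds f' h g, cancel f f' & cancel f' f].
Proof.
move=> [fI fE]; have [f' fK f'K] := injF_bij fI; exists f'; split=> //.
by split=> [|i j]; [exact: can_inj f'K | rewrite -fE !f'K].
Qed.

Lemma isobP n (g h : adjrel n) : reflect (exists f, embeds f g h) (isob g h).
Proof.
apply: (iffP existsP) => [[s /forallP sE]|[f [fI fE]]].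
  by exists s; split=> [|i j]; [exact: perm_inj | have /forallP/(_ j)/eqP := sE i].
by exists (perm fI); apply/forallP => i; apply/forallP => j; rewrite !permE fE.
Qed.

Lemma iso_classP n (g h : adjrel n) : simple h ->
  reflect (exists f, embeds f g h) (iso_class g == iso_class h).
Proof.
move=> sh; apply: (iffP eqP) => [E|[f fE]].
  have : h \in iso_class h by rewrite inE sh; apply/isobP; exists id; apply: embeds_id.
  by rewrite -E inE => /andP[_ /isobP].
have [f' [f'E _ _]] := embeds_inv fE.
apply/setP => k; rewrite !inE; congr andb; apply/isobP/isobP => -[e eE].
  by exists (e \o f'); apply: embeds_comp eE.
by exists (e \o f); apply: embeds_comp eE.
Qed.

Definition rooted_class n (p : adjrel n * 'I_n) : {set adjrel n * 'I_n} :=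
  [set q : adjrel n * 'I_n | simple q.1 & `[< exists2 f, embeds f p.1 q.1 & f p.2 = q.2 >]].

Lemma rooted_classP n (g h : adjrel n) x y : simple h ->
  reflect (exists2 f, embeds f g h & f x = y) (rooted_class (g, x) == rooted_class (h, y)).
Proof.
move=> sh; apply: (iffP eqP) => [E|[f fE fx]].
  have : (h, y) \in rooted_class (h, y).
    by rewrite inE sh; apply/asboolP; exists id; first exact: embeds_id.
  by rewrite -E inE => /andP[_ /asboolP].
have [f' [f'E fK _]] := embeds_inv fE.
apply/setP => k; rewrite !inE; congr andb; apply/asboolP/asboolP => -[e eE ex].
  by exists (e \o f'); [exact: embeds_comp eE | rewrite /= -fx fK].
by exists (e \o f); [exact: embeds_comp eE | rewrite /= fx].
Qed.

Lemma embeds_lift k n f f' (h h' : adjrel k) (g g' : adjrel n) s :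
    embeds f h g -> embeds f' h' g' -> embeds s g g' ->
    (forall i, exists j, f' j = s (f i)) ->
  exists2 e, embeds e h h' & forall i, f' (e i) = s (f i).
Proof.
move=> [fI fE] [f'I f'E] [sI sE] /choice[e eP]; exists e => //; split=> [i j ij|i j].
  by apply: fI; apply: sI; rewrite -!eP ij.
by rewrite -f'E !eP sE fE.
Qed.

Lemma embeds_tperm n (g : adjrel n) a b : simple g ->
  (forall v, v != a -> v != b -> g (v, a) = g (v, b)) -> embeds (tperm a b) g g.
Proof.
move=> /simpleP[irr sym] tw; split=> [|i j]; first exact: perm_inj.
case: tpermP => [->|->|/eqP ia /eqP ib]; case: tpermP => [->|->|/eqP ja /eqP jb];
  rewrite ?irr //; try exact: sym.
- by rewrite sym -tw // sym.
- by rewrite sym tw // sym.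
- exact: esym (tw _ ia ib).
- exact: tw.
Qed.

Lemma embeds_deg n f (g h : adjrel n) i : embeds f g h -> deg h (f i) = deg g i.
Proof.
move=> [fI fE]; rewrite !degE (reindex_inj fI) /=.
by apply: eq_bigr => j _; rewrite fE.
Qed.

(** * Conjugacy of star modules *)

Section StarConjugation.
Variables (n : nat) (g : adjrel n).
Hypothesis sg : simple g.

Let irr i : g (i, i) = false. Proof. by case/simpleP: sg. Qed.
Let sym i j : g (i, j) = g (j, i). Proof. by case/simpleP: sg. Qed.

(** The leaves form a full class of vertices with equal neighbourhoods: a vertex outside the star
    adjacent to the centre is adjacent to the leaves too. Star modules sharing a leaf thus share all
    leaves. *)
Lemma star_leaves_twins w a i v : star_module g w a ->
  (v \in codom w) = [forall u, g (u, v) == g (u, w i)].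
Proof.
move=> [wI wa adj]; apply/codomP/forallP => [[j ->] u|tw]; first by rewrite !adj.
have vw : g (v, w i) = false by rewrite sym (eqP (tw (w i))) irr.
have va : g (v, a) by rewrite sym (eqP (tw a)) adj eqxx.
apply/codomP; apply: contraFT vw => vN.
by rewrite adj vN va orbT.
Qed.

(** The leaf sets coincide, so the two centres have the same neighbours elsewhere and can be
    transposed. *)
Lemma star_conj_shared w a w' a' i j :
    star_module g w a -> star_module g w' a' -> w i = w' j ->
  exists s, [/\ embeds s g g, s a = a' & forall v, (s v \in codom w') = (v \in codom w)].
Proof.
move=> st st' wij.
have cod v : (v \in codom w') = (v \in codom w).
  by rewrite (star_leaves_twins j v st') (star_leaves_twins i v st) wij.
have [wI wa adj] := st; have [wI' wa' adj'] := st'.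
have aN : a \notin codom w by apply/codomP => -[k ak]; have := wa k; rewrite -ak eqxx.
have aN' : a' \notin codom w'.
  by apply/codomP => -[k ak]; have := wa' k; rewrite -ak eqxx.
exists (tperm a a'); split; last 1 first.
- move=> v; rewrite cod; case: tpermP => [->|->|//].
    by rewrite (negbTE aN) -cod (negbTE aN').
  by rewrite (negbTE aN) -cod (negbTE aN').
- apply: embeds_tperm => // v va va'.
  case: (boolP (v \in codom w)) => vw.
    have /codomP[k' ->] : v \in codom w' by rewrite cod.
    rewrite [RHS]sym adj' eqxx; have := vw; rewrite -cod => /codomP[k'' e].
    have /codomP[k e'] : w' k' \in codom w by rewrite -cod codom_f.
    by rewrite e' sym adj eqxx.
  have := adj i v; rewrite (negbTE va) vw /= => <-.
  by rewrite wij adj' (negbTE va') cod vw.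
- exact: tpermL.
Qed.

(** Disjoint leaf sets with a common centre are fully joined to each other and have the same
    neighbours elsewhere, so exchanging [w i] with [w' i] is an automorphism. *)
Lemma star_conj_center w w' a : star_module g w a -> star_module g w' a ->
  exists s, [/\ embeds s g g, s a = a & forall v, (s v \in codom w') = (v \in codom w)].
Proof.
move=> st st'; case: (boolP [exists i, w i \in codom w']) => [/existsP[i /codomP[j]]|].
  exact: star_conj_shared.
move=> /existsPn disj; have [wI wa adj] := st; have [wI' wa' adj'] := st'.
have disj' j : w' j \notin codom w.
  by apply/codomP => -[i e]; have := disj i; rewrite -e codom_f.
pose s v := if [pick i | w i == v] is Some i then w' i
            else if [pick i | w' i == v] is Some i then w i else v.
have sw i : s (w i) = w' i.
  by rewrite /s; case: pickP => [j /eqP/wI->//|/(_ i)]; rewrite eqxx.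
have sw' i : s (w' i) = w i.
  rewrite /s; case: pickP => [j /eqP e|_]; first by have := disj j; rewrite e codom_f.
  by case: pickP => [j /eqP/wI'->//|/(_ i)]; rewrite eqxx.
have so v : v \notin codom w -> v \notin codom w' -> s v = v.
  move=> vw vw'; rewrite /s; case: pickP => [j /eqP e|_].
    by rewrite -e codom_f in vw.
  by case: pickP => [j /eqP e|//]; rewrite -e codom_f in vw'.
have cases v : [\/ exists i, v = w i, exists i, v = w' i
                 | v \notin codom w /\ v \notin codom w'].
  case: (boolP (v \in codom w)) => [/codomP|] vw; first exact: Or31.
  by case: (boolP (v \in codom w')) => [/codomP|] vw'; [exact: Or32 | exact: Or33].
have aN : a \notin codom w by apply/codomP => -[k ak]; have := wa k; rewrite -ak eqxx.
have aN' : a \notin codom w' by apply/codomP => -[k ak]; have := wa' k; rewrite -ak eqxx.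
exists s; split; [split| |].
- apply: inv_inj => v; case: (cases v) => [[i ->]|[i ->]|[vw vw']].
  + by rewrite sw sw'.
  + by rewrite sw' sw.
  + by rewrite !so.
- have ww i j : g (w i, w j) = false by rewrite adj codom_f (negbTE (wa i)).
  have ww2 i j : g (w' i, w' j) = false by rewrite adj' codom_f (negbTE (wa' i)).
  have w1a i : g (w i, a) by rewrite sym adj eqxx.
  have ww' i j : g (w i, w' j) by rewrite adj' disj w1a orbT.
  have out v i : v \notin codom w -> v \notin codom w' -> g (v, w i) = g (v, w' i).
    by move=> vw vw'; rewrite adj adj' vw vw'.
  move=> u v; case: (cases u) => [[i ->]|[i ->]|[uw uw']];
    case: (cases v) => [[j ->]|[j ->]|[vw vw']]; rewrite ?sw ?sw' ?so ?ww ?ww2 ?ww' //.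
  + by rewrite sym ww'.
  + by rewrite sym -out // sym.
  + by rewrite sym ww'.
  + by rewrite sym out // sym.
  + by rewrite out.
  + by rewrite out.
- exact: so.
move=> v; case: (cases v) => [[i ->]|[i ->]|[vw vw']].
- by rewrite sw !codom_f.
- by rewrite sw' (negbTE (disj' i)) (negbTE (disj i)).
- by rewrite so // (negbTE vw) (negbTE vw').
Qed.

End StarConjugation.

(** * Comparing rooted and unrooted classes *)

Definition star_classes r n : {set {set adjrel n}} :=
  [set iso_class g | g in [set g : adjrel n | [&& simple g, cograph g & star_hit r g]]].

Definition rooted_star_classes r n : {set {set adjrel n * 'I_n}} :=
  [set rooted_class p | p in [set p : adjrel n * 'I_n |
     [&& simple p.1, cograph p.1 & star_hit r p.1]]].

(** Replacing the root by a star forgets only which star was inserted. The star meets a hitting set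
    of at most [r + 3] vertices in its centre or in a leaf, which leaves [2 * (r + 3)] cases up to
    automorphism. *)
Lemma card_rooted_star_classes r k :
  #|rooted_star_classes r k| <= 2 * (r + 3) * #|star_classes (r + 3) (k + 3)|.
Proof.
pose rho (R : {set adjrel k * 'I_k}) (C : {set adjrel (k + 3)}) :=
  exists g y, [/\ simple g, R = rooted_class (g, y) & C = iso_class (blow_star g y)].
apply: (leq_card_fiber (rho := rho)) => [R /imsetP[[g y] gP ->]|C A'].
  move: gP; rewrite inE /= => /and3P[sg cg hg].
  exists (iso_class (blow_star g y)); last by exists g, y.
  rewrite imset_f // inE simple_blow_star // cograph_blow_star //=.
  by have := star_hit_embeds (embeds_blow_star g y) hg; rewrite addKn.
move=> /imsetP[G]; rewrite inE => /and3P[sG _ /asboolP[X hX cX]] -> _ A'G.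
(* A label is a vertex of [X] with a flag telling whether it is the centre or a leaf. Deleting the
   leaves and rooting at the centre gives back [(g, y)]. *)
pose rho' (R : {set adjrel k * 'I_k}) (l : 'I_(k + 3) * bool) :=
  exists g y f w, [/\ R = rooted_class (g, y) /\ simple g, embeds f g G,
    star_module G w (f y), forall v, (v \in codom f) = (v \notin codom w)
    & if l.2 then f y = l.1 else exists i, w i = l.1].
have le : #|A'| <= #|setX X [set: bool]|.
  apply: (leq_card_rel (rho := rho')) => [R /A'G[g [y [sg -> /esym/eqP]]]|].
    case/(iso_classP _ sG) => F FE.
    have [FI FA] := FE; have [rI ra adj] := star_module_blow_star y sg.
    have [F' [_ FK F'K]] := embeds_inv FE.
    have st : star_module G (F \o @rshift k 3) (F (@lshift k 3 y)).
      split=> [||i v] /=; [exact: inj_comp | by move=> i; rewrite (inj_eq FI) |].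
      rewrite -[v]F'K !FA adj (inj_eq FI); congr (_ || ~~ _ && _).
      by apply/codomP/codomP => -[j] => [|/= /FI] ->; exists j.
    have cod v : (v \in codom (F \o @lshift k 3)) = (v \notin codom (F \o @rshift k 3)).
      rewrite -[v]F'K; have [i ->|i ->] := split_ordP (F' v).
        rewrite (codom_f (F \o @lshift k 3) i); apply/esym/codomP => -[j /= /FI/eqP].
        by rewrite eq_lrshift.
      rewrite (codom_f (F \o @rshift k 3) i); apply/codomP => -[j /= /FI/eqP].
      by rewrite eq_rlshift.
    have emb := embeds_comp (embeds_blow_star g y) FE.
    have [xX|[i xX]] := hX _ _ st; [exists (F (@lshift k 3 y), true)|
      exists (F (@rshift k 3 i), false)]; rewrite ?in_setX ?xX ?in_setT //;
      exists g, y, (F \o @lshift k 3), (F \o @rshift k 3); split=> //.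
    by exists i.
  move=> R R' [x b] _ _ [g [y [f [w [[-> sg] fE st cod lab]]]]].
  move=> [g' [y' [f' [w' [[-> sg'] f'E st' cod' lab']]]]].
  have [s [sE sa sw]] : exists s, [/\ embeds s G G, s (f y) = f' y'
      & forall v, (s v \in codom w') = (v \in codom w)].
    case: b lab lab' => /= [e e'|[i e] [j e']].
      by move: st'; rewrite e' -e; apply: star_conj_center.
    by apply: (star_conj_shared sG st st' (i := i) (j := j)); rewrite e e'.
  (* Equal labels give conjugate stars; the conjugation preserves the complements of the leaf sets
     and restricts to a rooted isomorphism. *)
  have [i|e eE eP] := embeds_lift fE f'E sE.
    have : s (f i) \in codom f' by rewrite cod' sw -cod codom_f.
    by case/codomP => j ->; exists j.
  apply/eqP/(rooted_classP _ _ _ sg'); exists e => //.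
  by have [f'I _] := f'E; apply: f'I; rewrite eP.
apply: leq_trans le _.
by rewrite cardsX cardsT card_bool mulnC leq_mul2l cX orbT.
Qed.

Lemma add_vertex_cancel n (g g' : adjrel n) N N' F :
  embeds F (add_vertex g N) (add_vertex g' N') -> F ord0 = ord0 ->
  exists e, embeds e g g'.
Proof.
move=> FE F0; have [|e eE _] := embeds_lift (embeds_add_vertex g N) (embeds_add_vertex g' N') FE.
  move=> i; case: (unliftP ord0 (F (lift ord0 i))) => [j ->|]; first by exists j.
  move=> Fi; have /FE.1/eqP : F (lift ord0 i) = F ord0 by rewrite Fi F0.
  by rewrite eq_sym (negbTE (neq_lift _ _)).
by exists e.
Qed.

(** Rooting at the added vertex makes it removable, so [g] is recovered up to isomorphism, while the
    degree of the root separates at least [k] extensions of each [g]. *)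
Lemma card_star_classes_mul r n k : 2 ^ (2 * k) <= n ->
  #|star_classes r n| * k <= #|rooted_star_classes r.+1 n.+1|.
Proof.
move=> len.
pose rho (C : {set adjrel n}) (R : {set adjrel n.+1 * 'I_n.+1}) :=
  exists g N, [/\ simple g, C = iso_class g & R = rooted_class (add_vertex g N, ord0)].
apply: (leq_mul_card_rel (rho := rho)) => [C /imsetP[g]|C C' R _ _]; last first.
  move=> [g [N [sg -> ->]]] [g' [N' [sg' -> /eqP]]].
  case/(rooted_classP _ _ _ (simple_add_vertex N' sg')) => F FE F0.
  by apply/eqP/(iso_classP _ sg'); apply: add_vertex_cancel FE F0.
rewrite inE => /and3P[sg cg hg] ->.
have [c lec] := vicinity_sizes_large sg cg len; apply: leq_trans lec _.
pose rho' (d : 'I_n.+1) (R : {set adjrel n.+1 * 'I_n.+1}) :=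
  exists N : {set 'I_n}, #|N| = d /\ R = rooted_class (add_vertex g N, ord0).
apply: (leq_card_rel (rho := rho')) => [d|d d' R _ _].
  rewrite inE => /asboolP[S [_ S0 mS dE]]; set N := vicinity g S c in dE.
  exists (rooted_class (add_vertex g N, ord0)); last by exists N.
  rewrite inE; apply/andP; split; last by apply/asboolP; exists g, N.
  rewrite imset_f // inE /= simple_add_vertex // cograph_add_vertex //=.
  by have := star_hit_embeds (embeds_add_vertex g N) hg; rewrite subSnn addn1.
move=> [N [Nd ->]] [N' [N'd' /eqP]].
case/(rooted_classP _ _ _ (simple_add_vertex N' sg)) => F FE F0.
apply: val_inj => /=; rewrite -Nd -N'd' -(deg_add_vertex g N) -(deg_add_vertex g N').
by rewrite -(embeds_deg ord0 FE) F0.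
Qed.

(** An isolated vertex is added. Isolated vertices are interchangeable, so an isomorphism between
    the extensions can be corrected to fix the new one. *)
Lemma cograph_classes_leqS n : 0 < n -> cograph_classes n <= cograph_classes n.+1.
Proof.
move=> n0; rewrite /cograph_classes.
pose rho (C : {set adjrel n}) (D : {set adjrel n.+1}) :=
  exists g, [/\ simple g, C = iso_class g & D = iso_class (add_vertex g set0)].
apply: (leq_card_rel (rho := rho)) => [C /imsetP[g]|C C' D _ _].
  rewrite inE => /andP[sg cg] ->; exists (iso_class (add_vertex g set0)); last by exists g.
  rewrite imset_f // inE simple_add_vertex //=.
  have -> : set0 = vicinity g setT false by apply/setP => x; rewrite !inE.
  apply: cograph_add_vertex => //; first by move=> x ? ?; rewrite inE.
  by rewrite -card_gt0 cardsT card_ord.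
move=> [g [sg -> ->]] [g' [sg' -> /eqP]].
set h := add_vertex g' set0; have sh : simple h by apply: simple_add_vertex.
case/(iso_classP _ sh) => F FE; have [FI FA] := FE.
have [E1 E2 E3 E4] := add_vertexE g set0; have [E1' E2' E3' E4'] := add_vertexE g' set0.
have iso0 v : h (v, ord0) = false.
  by case: (unliftP ord0 v) => [i|] ->; rewrite ?E2' ?E4' ?inE.
have isoF v : h (v, F ord0) = false.
  have [F' [_ _ F'K]] := embeds_inv FE; rewrite -[v]F'K FA.
  by case: (unliftP ord0 (F' v)) => [i|] ->; rewrite ?E2 ?E4 ?inE.
have tE : embeds (tperm (F ord0) ord0) h h.
  by apply: embeds_tperm => // v _ _; rewrite iso0 isoF.
apply/eqP/(iso_classP _ sg'); apply: (add_vertex_cancel (embeds_comp FE tE)).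
by rewrite /= tpermL.
Qed.

Lemma leq_cograph_classes m n : 0 < m <= n -> cograph_classes m <= cograph_classes n.
Proof.
case/andP=> m0; elim: n => [|n IH]; first by rewrite leqn0 => /eqP->.
rewrite leq_eqVlt => /predU1P[->//|mn]; apply: leq_trans (IH mn) _.
by apply: cograph_classes_leqS; apply: leq_trans m0 mn.
Qed.

Lemma star_classes_leq r n : #|star_classes r n| <= cograph_classes n.
Proof.
apply/subset_leq_card/imsetS/subsetP => g; rewrite !inE.
by case/and3P => -> ->.
Qed.

(** * Star-free cographs are rare *)

(** Halving a module of more than [2 * b] vertices keeps at least [b] of them, so the process stops
    in the desired range. *)
Lemma module_of_size n (g : adjrel n) b (S : {set 'I_n}) : simple g -> cograph g ->
    module g S -> 0 < b <= #|S| ->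
  exists M : {set 'I_n}, module g M /\ b <= #|M| <= 2 * b.
Proof.
move=> sg cg; have [k] := ubnP #|S|; elim: k S => // k IH S ltk mS /andP[b0 bS].
have [leS|ltS] := leqP #|S| (2 * b); first by exists S; rewrite bS.
have [|C [c [[_ /proper_card CS _] mC leC]]] := module_halve sg cg mS.
  by apply: leq_trans ltS; lia.
apply: (IH C) => //; first exact: leq_trans CS ltk.
by rewrite b0 /=; have := leq_trans ltS leC; rewrite ltn_pmul2l // => /ltnW.
Qed.

Lemma enum_injection n k (A : {set 'I_n}) : #|A| = k ->
  exists f : 'I_k -> 'I_n, injective f /\ forall v, (v \in codom f) = (v \in A).
Proof.
move=> <-; exists enum_val; split; first exact: enum_val_inj.
move=> v; apply/codomP/idP => [[i ->]|vA]; first exact: enum_valP.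
by exists (enum_rank_in vA v); rewrite enum_rankK_in.
Qed.

Definition unmated_classes n : {set {set adjrel n}} :=
  [set iso_class g | g in [set g : adjrel n | [&& simple g, cograph g & ~~ has_gQ_mate g]]].

(* [g] arises from [h] by substituting the graph [t] for the vertex [y]. *)
Definition substitution k m n (h : adjrel k) y (t : adjrel m) (g : adjrel n) : Prop :=
  exists f u, [/\ embeds f h g, embeds u t g, f y \in codom u,
    module g [set v in codom u]
    & forall v, v != f y -> (v \in codom f) = (v \notin codom u)].

(** The isomorphism [F] is glued from [u i] to [u' i] on the module and from [f j] to [f' (e j)]
    elsewhere; edges between the two parts depend only on the root. *)
Lemma substitution_uniq k m n (h h' : adjrel k) y y' (t : adjrel m) (g g' : adjrel n) :
    simple g -> simple g' -> simple h' ->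
    substitution h y t g -> substitution h' y' t g' ->
    rooted_class (h, y) = rooted_class (h', y') ->
  iso_class g = iso_class g'.
Proof.
move=> sg sg' sh' [f [u [[fI fE] [uI uE] fyu mu cod]]].
move=> [f' [u' [[f'I f'E] [u'I u'E] fyu' mu' cod']]].
case/eqP/(rooted_classP _ _ _ sh') => e [eI eE] ey.
have [_ sym] := simpleP _ sg; have [_ sym'] := simpleP _ sg'.
have outE j : j != y -> f j \notin codom u by move=> jy; rewrite -cod ?codom_f // (inj_eq fI).
have outE' j : j != y -> f' (e j) \notin codom u'.
  by move=> jy; rewrite -cod' ?codom_f // -ey (inj_eq f'I) (inj_eq eI).
pose P v v' := (exists2 i, v = u i & v' = u' i) \/
               (exists j, [/\ j != y, v = f j & v' = f' (e j)]).
have /choice[F FP] v : exists v', P v v'.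
  case: (boolP (v \in codom u)) => [/codomP[i ->]|vu]; first by exists (u' i); left; exists i.
  have vfy : v != f y by apply: contraNneq vu => ->.
  have /codomP[j vj] : v \in codom f by rewrite cod.
  by exists (f' (e j)); right; exists j; rewrite -(inj_eq fI) -vj.
have mix j i : j != y -> g (f j, u i) = h (j, y).
  by move=> jy; rewrite -fE; apply: mu; rewrite ?inE ?outE ?codom_f.
have mix' j i : j != y -> g' (f' (e j), u' i) = h (j, y).
  by move=> jy; rewrite -eE -f'E ey; apply: mu'; rewrite ?inE ?outE' ?codom_f.
apply/eqP/(iso_classP _ sg'); exists F; split=> [v v'|v v'].
  case: (FP v) (FP v') => [[i -> ->]|[j [jy -> ->]]] [[i' -> ->]|[j' [jy' -> ->]]].
  - by move=> /u'I->.
  - by move=> E; have := outE' _ jy'; rewrite -E codom_f.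
  - by move=> E; have := outE' _ jy; rewrite E codom_f.
  - by move=> /f'I/eI->.
case: (FP v) (FP v') => [[i -> ->]|[j [jy -> ->]]] [[i' -> ->]|[j' [jy' -> ->]]].
- by rewrite uE u'E.
- by rewrite sym' sym mix // mix'.
- by rewrite mix // mix'.
- by rewrite fE f'E eE.
Qed.

(** A star module of [h] avoiding [y] would be one of [g], because each vertex of the substituted
    module sees it as [y] does. So [[set y]] is a hitting set. *)
Lemma star_hit_contract k m n (h : adjrel k) y (t : adjrel m) (g : adjrel n) :
    simple g -> substitution h y t g -> (forall w a, ~ star_module g w a) ->
  star_hit 1 h.
Proof.
move=> sg [f [u [[fI fE] _ fyu mu cod]]] nostar; have [_ sym] := simpleP _ sg.
apply/asboolP; exists [set y]; last by rewrite cards1.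
move=> w a [wI wa adj]; rewrite inE; case: (eqVneq a y) => [|ay]; first by left.
case: (boolP [exists i, w i == y]) => [/existsP[i /eqP wy]|/existsPn wy].
  by right; exists i; rewrite wy inE.
case: (nostar (f \o w) (f a)); split=> [|i|i v] /=; first exact: inj_comp.
  by rewrite (inj_eq fI).
have out j : j != y -> f j \notin codom u by move=> jy; rewrite -cod ?codom_f // (inj_eq fI).
have codw j : (f j \in codom (f \o w)) = (j \in codom w).
  by apply/codomP/codomP => -[i'] => [/fI|] ->; exists i'.
case: (boolP (v \in codom u)) => vu.
  have modv j : j != y -> g (v, f j) = h (y, j).
    by move=> jy; rewrite -fE ![g (_, f j)]sym; apply: mu; rewrite inE // out.
  rewrite !modv // adj eq_sym (negbTE ay) /=.
  have -> : v == f a = false by apply: contraTF vu => /eqP->; apply: out.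
  have -> : (y \in codom w) = false.
    by apply/codomP => -[i' yw]; have := wy i'; rewrite -yw eqxx.
  suff -> : (v \in codom (f \o w)) = false by [].
  by apply: contraTF vu => /codomP[i' ->]; apply: out.
have /codomP[j ->] : v \in codom f by rewrite cod //; apply: contraNneq vu => ->.
by rewrite !fE adj (inj_eq fI) codw.
Qed.

Lemma contract_module n (g : adjrel n) (M : {set 'I_n}) : M != set0 -> module g M ->
  exists (h : adjrel (n - #|M|).+1) y (t : adjrel #|M|), substitution h y t g.
Proof.
move=> /set0Pn[x xM] mM; pose A := x |: ~: M.
have cA : #|A| = (n - #|M|).+1.
  by rewrite cardsU1 inE xM cardsCs setCK card_ord.
have [f [fI fA]] := enum_injection cA; have [u [uI uM]] := enum_injection (erefl #|M|).
have /codomP[y xy] : x \in codom f by rewrite fA setU11.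
exists [ffun p => g (f p.1, f p.2)], y, [ffun p => g (u p.1, u p.2)], f, u.
split; rewrite -?xy ?uM //; first by split=> // i j; rewrite ffunE.
- by split=> // i j; rewrite ffunE.
- by have -> : [set v in codom u] = M by apply/setP => v; rewrite inE uM.
- by move=> v vx; rewrite fA uM !inE (negbTE vx).
Qed.

(** The sets [U m] cover the unmated classes, and a class in [U m] is determined by the rooted
    quotient and a labelled graph on [m] vertices. *)
Lemma card_unmated_classes n : 7 < n ->
  #|unmated_classes n| <=
    \sum_(8 <= m < 17) #|rooted_star_classes 1 (n - m).+1| * #|adjrel m|.
Proof.
move=> n7.
pose rho m (C : {set adjrel n})
    (Rt : {set adjrel (n - m).+1 * 'I_(n - m).+1} * adjrel m) :=
  exists g h y, [/\ simple g, simple h, C = iso_class g, Rt.1 = rooted_class (h, y)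
                  & substitution h y Rt.2 g].
pose B m := setX (rooted_star_classes 1 (n - m).+1) [set: adjrel m].
pose U m := [set C in unmated_classes n | `[< exists2 Rt, Rt \in B m & rho m C Rt >]].
have cU m : #|U m| <= #|rooted_star_classes 1 (n - m).+1| * #|adjrel m|.
  rewrite -[#|adjrel m|]cardsT -cardsX; apply: (leq_card_rel (rho := @rho m)) => [C|].
    by rewrite inE => /andP[_ /asboolP].
  move=> C C' [R t] _ _ [g [h [y [sg sh -> /= -> s]]]] [g' [h' [y' [sg' sh' -> /= e s']]]].
  exact: substitution_uniq s s' e.
apply: leq_trans (leq_sum _ (fun m _ => cU m)).
rewrite -sum1_card; under [leqRHS]eq_bigr do rewrite -sum1_card.
rewrite (exchange_big_dep (mem (unmated_classes n))) /=; last first.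
  by move=> m C _; rewrite inE => /andP[].
apply: leq_sum => C CU; have /imsetP[g gP CE] := CU.
move: gP; rewrite inE => /and3P[sg cg unm].
have nostar w a : ~ star_module g w a.
  by move=> /(star_module_mate sg); rewrite (negbTE unm).
have mT : module g setT by move=> x ? ?; rewrite inE.
have [|M [mM /andP[M8 M16]]] := @module_of_size n g 8 setT sg cg mT.
  by rewrite cardsT card_ord.
have M0 : M != set0 by rewrite -card_gt0; apply: leq_trans M8.
have [h [y [t sub]]] := contract_module M0 mM.
have CUM : C \in U #|M|.
  rewrite inE CU; apply/asboolP; exists (rooted_class (h, y), t).
    have [f [_ [fE _ _ _ _]]] := sub.
    rewrite in_setX inE andbT imset_f // inE /= (embeds_simple fE sg).
    by rewrite (embeds_cograph fE sg cg) (star_hit_contract sg sub nostar).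
  have [f [_ [fE _ _ _ _]]] := sub.
  by exists g, h, y; split=> //; apply: embeds_simple fE sg.
rewrite sum1_count -has_count; apply/hasP; exists #|M| => //.
by rewrite mem_index_iota M8.
Qed.

Lemma unmated_classes_small : exists c, forall n k, 2 ^ (2 * k) + 16 <= n ->
  #|unmated_classes n| * k <= c * cograph_classes n.
Proof.
(* The factor [128] is [2 * (1 + 3)] times [2 * (5 + 3)] from the two star insertions. The graph
   grows from [n - m + 1] by [3 + 1 + 3] vertices, to at most [n] since [m >= 8]; as [m <= 16], the
   term [16] keeps enough vertices for the vicinity bound. *)
exists (\sum_(8 <= m < 17) 128 * #|adjrel m|) => n k nk.
have k0 : 0 < 2 ^ (2 * k) by rewrite expn_gt0.
apply: leq_trans (leq_mul (card_unmated_classes _) (leqnn k)) _; first by lia.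
rewrite !big_distrl /= !big_nat; apply: leq_sum => m /andP[m8 m17].
set j := (n - m).+1.
have b1 := card_rooted_star_classes 1 j.
have lek : 2 ^ (2 * k) <= j + 3 by rewrite /j; lia.
have b2 := card_star_classes_mul (1 + 3) lek.
have b3 := card_rooted_star_classes (1 + 3).+1 (j + 3).+1.
have b4 := star_classes_leq ((1 + 3).+1 + 3) ((j + 3).+1 + 3).
have b5 : cograph_classes ((j + 3).+1 + 3) <= cograph_classes n.
  by apply: leq_cograph_classes; rewrite /j; lia.
have chain : #|rooted_star_classes 1 j| * k <= 128 * cograph_classes n.
  apply: leq_trans (leq_mul b1 (leqnn k)) _; rewrite -mulnA.
  apply: leq_trans (leq_mul (leqnn _) (leq_trans b2 b3)) _.
  rewrite mulnA; apply: leq_mul => //; exact: leq_trans b4 b5.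
by rewrite mulnAC [leqRHS]mulnAC leq_mul2r chain orbT.
Qed.

Lemma cograph_classes_gt0 n : 0 < cograph_classes n.
Proof.
apply/card_gt0P; exists (iso_class [ffun=> false]); rewrite imset_f // inE.
have s0 : simple ([ffun=> false] : adjrel n) by apply/simpleP; split=> *; rewrite !ffunE.
by rewrite s0; apply/(cographP s0) => a b c d; rewrite /is_P4 !ffunE.
Qed.

Lemma mated_classes_bounds n :
  mated_cograph_classes n <= cograph_classes n <= mated_cograph_classes n + #|unmated_classes n|.
Proof.
apply/andP; split.
  by apply/subset_leq_card/imsetS/subsetP => g; rewrite !inE => /and3P[-> ->].
apply: leq_trans (leq_card_setU _ _); apply: subset_leq_card; rewrite -imsetU.
apply/imsetS/subsetP => g; rewrite !inE => /andP[-> ->] /=.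
by case: (has_gQ_mate g).
Qed.

(** * The limit *)

Local Open Scope ring_scope.

(* q_n / c_n -> 1 as n -> oo (epsilon-N definition of the limit, in rat) *)
Theorem theorem4p4 :
  forall eps : rat, 0 < eps ->
  exists N : nat, forall n : nat, (N <= n)%N ->
    `| (mated_cograph_classes n)%:R / (cograph_classes n)%:R - 1 | < eps.
Proof.
move=> eps eps0; have [c cP] := unmated_classes_small.
(* The unmated proportion is at most [c / k], so [k] is taken above [c / eps]. *)
pose k := Num.bound (c%:R / eps).
have ck : c%:R < k%:R * eps.
  by rewrite -ltr_pdivrMr // archi_boundP // divr_ge0 ?ler0n // ltW.
exists (2 ^ (2 * k) + 16)%N => n /cP uk.
have cn := cograph_classes_gt0 n; have /andP[qc cu] := mated_classes_bounds n.
set C : rat := (cograph_classes n)%:R; set q : rat := (mated_cograph_classes n)%:R.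
have C0 : 0 < C by rewrite ltr0n.
have -> : q / C - 1 = - ((C - q) / C) by rewrite mulrBl divff ?gt_eqF // opprB.
rewrite normrN ger0_norm; last by rewrite divr_ge0 ?subr_ge0 ?ler_nat // ltW.
rewrite ltr_pdivrMr //.
have u1 : C - q <= #|unmated_classes n|%:R by rewrite lerBlDl -natrD ler_nat.
apply: le_lt_trans u1 _.
have u2 : #|unmated_classes n|%:R * k%:R <= c%:R * C by rewrite -!natrM ler_nat.
have k0 : 0 < k%:R :> rat.
  by rewrite -(pmulr_lgt0 _ eps0); apply: le_lt_trans ck; rewrite ler0n.
rewrite -(ltr_pM2r k0); apply: le_lt_trans u2 _.
by rewrite mulrAC ltr_pM2r // mulrC.
Qed.
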